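(* Let $K$ be an infinite field, $n\ge2$, $m\ge1$, $\ell_1,\dots,\ell_n$ positive integers, $S=K[x_1,\dots,x_n]$ and $P=K[y_1,\dots,y_n]$. Let $\Gamma=\bigcap_{k=1}^n(x_1^{\ell_1},\dots,\widehat{x_k^{\ell_k}},\dots,x_n^{\ell_n})^m\subset S$ and $\overline\Gamma=\bigcap_{k=1}^n(y_1,\dots,\widehat{y_k},\dots,y_n)^m\subset P$, and let $\Phi:P\to S$ be the $K$-algebra homomorphism with $\Phi(y_i)=x_i^{\ell_i}$. Then the ideal $\Gamma$ is weighted by $(\ell_1,\dots,\ell_n)$, with minimal monomial basis $$B_\Gamma=\Phi(B_{\overline\Gamma})=\bigcup_{t=1}^m\Bigl\{x_1^{\ell_1b_1}\cdots x_n^{\ell_nb_n}\ \Big|\ \sum_ib_i=m+t;\ b_i\le t\ \ \forall i=1,\dots,n;\ \exists\,1\le u<v\le n\text{ with }b_u=b_v=t\Bigr\}.$$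
   Context: $B_J$ denotes the minimal monomial generating set of a monomial ideal $J$; $\widehat{\ }$ denotes omission; the $b_i$ are non-negative integers. A monomial ideal $J\subset S$ is weighted by $(\ell_1,\dots,\ell_n)$ if $B_J$ consists of terms of the form $x_1^{\alpha_1\ell_1}\cdots x_n^{\alpha_n\ell_n}$. *)

(* Defs.v *)
From HB Require Import structures.
From mathcomp Require Import all_boot all_order all_algebra.
From mathcomp Require Import boolp classical_sets functions cardinality.
From mathcomp Require Import mpoly.
Set Implicit Arguments.
Unset Strict Implicit.
Unset Printing Implicit Defensive.
Import GRing.Theory.
Local Open Scope ring_scope.
Local Open Scope classical_set_scope.

(* MathComp's [idealr] covers only proper, boolean ideals; here the unit ideal
   is allowed and membership is a proposition. *)
Definition is_ideal (R : comNzRingType) (I : set R) : Prop :=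
  [/\ I 0,
      forall x y, I x -> I y -> I (x + y)
    & forall a x, I x -> I (a * x)].

Definition ideal_gen (R : comNzRingType) (A : set R) : set R :=
  smallest (@is_ideal R) A.

Definition ideal_pow (R : comNzRingType) (I : set R) (m : nat) : set R :=
  ideal_gen [set \prod_(j < m) f j | f in [set f : 'I_m -> R | forall j, I (f j)]].

Definition monomials (K : fieldType) (n : nat) : set {mpoly K[n]} :=
  range (fun a : 'X_{1..n} => 'X_[a]).

Definition is_monomial_ideal (K : fieldType) (n : nat) (J : set {mpoly K[n]}) :
    Prop :=
  exists2 A : set {mpoly K[n]}, A `<=` @monomials K n & J = ideal_gen A.

Definition is_min_monomial_gens (K : fieldType) (n : nat)
    (J B : set {mpoly K[n]}) : Prop :=
  [/\ B `<=` @monomials K n,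
      J = ideal_gen B
    & forall B', B' `<=` B -> J = ideal_gen B' -> B' = B].

(* The set B_J. It is unique for any J, and it exists when J is a monomial
   ideal: see [is_min_monomial_gens_unique] and [monomial_basisP] below. *)
Definition monomial_basis (K : fieldType) (n : nat) (J : set {mpoly K[n]}) :
    set {mpoly K[n]} :=
  xget set0 [set B | is_min_monomial_gens J B].

Definition weighted (K : fieldType) (n : nat) (l : 'I_n -> nat)
    (J : set {mpoly K[n]}) : Prop :=
  is_monomial_ideal J /\
  monomial_basis J `<=`
    [set \prod_(i < n) 'X_i ^+ (a i * l i) | a in [set: 'I_n -> nat]].

Definition Gamma (K : fieldType) (n m : nat) (l : 'I_n -> nat) :
    set {mpoly K[n]} :=
  \bigcap_(k in [set: 'I_n])
    ideal_pow (ideal_gen [set 'X_i ^+ l i | i in [set i : 'I_n | i != k]]) m.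

Definition Gammabar (K : fieldType) (n m : nat) : set {mpoly K[n]} :=
  \bigcap_(k in [set: 'I_n])
    ideal_pow (ideal_gen [set 'X_i | i in [set i : 'I_n | i != k]]) m.

Arguments Gamma K {n} m l _.
Arguments Gammabar : clear implicits.

Section MonomialBasis.
Context (K : fieldType) (n : nat).
Implicit Types (A B J : set {mpoly K[n]}) (a b : 'X_{1..n}).

Lemma ideal_gen_ideal (R : comNzRingType) (A : set R) : is_ideal (ideal_gen A).
Proof.
split=> [I [[]] //|x y Ix Iy I HI|a x Ix I HI].
  by case: (HI) => -[_ + _] _; apply; [exact: Ix|exact: Iy].
by case: (HI) => -[_ _ +] _; apply; exact: Ix.
Qed.

Lemma sub_ideal_gen (R : comNzRingType) (A : set R) : A `<=` ideal_gen A.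
Proof. by move=> x Ax I [_]; exact. Qed.

Lemma ideal_gen_min (R : comNzRingType) (A I : set R) :
  is_ideal I -> A `<=` I -> ideal_gen A `<=` I.
Proof. by move=> HI AI x; apply; split. Qed.

Lemma ideal_gen_dvd A a b :
  ideal_gen A 'X_[b] -> (b <= a)%MM -> ideal_gen A 'X_[a].
Proof.
move=> Ab ba; rewrite -(submK ba) mpolyXD.
by case: (ideal_gen_ideal A) => _ _; apply.
Qed.

Lemma ideal_gen_monomialP A a : A `<=` @monomials K n ->
  ideal_gen A 'X_[a] -> exists2 b, A 'X_[b] & (b <= a)%MM.
Proof.
move=> Amon.
pose I : set {mpoly K[n]} :=
  [set p | forall c, c \in msupp p -> exists2 b, A 'X_[b] & (b <= c)%MM].
suff /[apply] : ideal_gen A `<=` I by apply; rewrite msuppX mem_head.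
apply: ideal_gen_min => [|p Ap c].
  split=> [c|x y Ix Iy c|p q Iq c]; first by rewrite msupp0.
    by move/msuppD_le; rewrite mem_cat => /orP[/Ix|/Iy].
  move/msuppM_le/allpairsP => -[[c1 c2] /= [_ /Iq[b Ab bc] ->]].
  by exists b => //; exact: (lepm_trans bc (lem_addl _ _)).
case: (Amon p Ap) => b _ pb; move: Ap; rewrite -pb => Ab.
by rewrite msuppX inE => /eqP ->; exists b => //; exact: lepm_refl.
Qed.

Lemma min_monomial_gens_antichain J B a b : is_min_monomial_gens J B ->
  B 'X_[a] -> B 'X_[b] -> (b <= a)%MM -> b = a.
Proof.
case=> Bmon JB Bmin Ba Bb ba; apply/eqP/negP => /negP neq.
have sB : B `\ 'X_[a] `<=` B by move=> x [].
suff /(Bmin _ sB) BB : J = ideal_gen (B `\ 'X_[a]).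
  by move: Ba; rewrite -BB => -[_]; apply.
rewrite JB eqEsubset; split; apply: ideal_gen_min; try exact: ideal_gen_ideal.
  move=> x Bx; have [->|/eqP xa] := eqVneq x 'X_[a]; last exact: sub_ideal_gen.
  apply: ideal_gen_dvd ba; apply: sub_ideal_gen; split=> // /= /(congr1 (@msupp _ _)).
  by rewrite !msuppX => -[] /eqP; apply/negP.
by move=> x /sB; exact: sub_ideal_gen.
Qed.

Lemma is_min_monomial_gens_unique J B1 B2 :
  is_min_monomial_gens J B1 -> is_min_monomial_gens J B2 -> B1 = B2.
Proof.
suff sub C1 C2 : is_min_monomial_gens J C1 -> is_min_monomial_gens J C2 ->
    C1 `<=` C2.
  by move=> h1 h2; rewrite eqEsubset; split; exact: sub.
move=> h1 h2 x C1x; case: (h1) => mon1 J1 _; case: (h2) => mon2 J2 _.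
case: (mon1 x C1x) => a _ xa; move: C1x; rewrite -xa => C1a {x xa}.
have := sub_ideal_gen C1a; rewrite -J1 J2 => /(ideal_gen_monomialP mon2)[b C2b ba].
have := sub_ideal_gen C2b; rewrite -J2 J1 => /(ideal_gen_monomialP mon1)[c C1c cb].
have ca := min_monomial_gens_antichain h1 C1a C1c (lepm_trans cb ba).
suff -> : a = b by [].
apply/mnmP => i; apply/eqP; rewrite eqn_leq (mnm_lepP ba) andbT.
by rewrite -{1}ca (mnm_lepP cb).
Qed.

Lemma is_min_monomial_gens_exists J : is_monomial_ideal J ->
  exists B, is_min_monomial_gens J B.
Proof.
case=> A Amon ->.
pose B : set {mpoly K[n]} := [set 'X_[a] | a in
  [set a | A 'X_[a] /\ forall b, A 'X_[b] -> (b <= a)%MM -> b = a]].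
have BA : B `<=` A by move=> _ [a [Aa _] <-].
have AB a : A 'X_[a] -> exists2 b, B 'X_[b] & (b <= a)%MM.
  have [d] := ubnP (mdeg a); elim: d a => // d IH a ad Aa.
  have [h|] := pselect (forall b, A 'X_[b] -> (b <= a)%MM -> b = a).
    by exists a; [exists a|exact: lepm_refl].
  move=> /existsNP[b /not_implyP[Ab /not_implyP[ba nab]]].
  have [|c Bc cb] := IH b _ Ab; last by exists c => //; exact: lepm_trans cb ba.
  rewrite (leq_trans _ (ad : mdeg a <= d)%N) //.
  rewrite -(submK ba) mdegD -[ltnLHS]add0n ltn_add2r lt0n mdeg_eq0.
  apply/eqP => ab0; apply: nab.
  by rewrite -[a](submK ba) ab0 add0m.
exists B; split.
- by move=> x /BA /Amon.
- rewrite eqEsubset; split; apply: ideal_gen_min; try exact: ideal_gen_ideal.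
    move=> x Ax; case: (Amon x Ax) => a _ xa; move: Ax; rewrite -xa.
    by move=> /AB[b Bb ba]; apply: ideal_gen_dvd ba; exact: sub_ideal_gen.
  by move=> x /BA; exact: sub_ideal_gen.
- move=> B' B'B eqB'; rewrite eqEsubset; split=> // _ [a [Aa amin] <-].
  have := sub_ideal_gen Aa; rewrite eqB' => /ideal_gen_monomialP[|b B'b ba].
    by move=> x /B'B /BA /Amon.
  by rewrite -(amin b) //; exact/BA/B'B.
Qed.

Lemma monomial_basisP J : is_monomial_ideal J ->
  is_min_monomial_gens J (monomial_basis J).
Proof.
move=> /is_min_monomial_gens_exists[B HB].
exact: (xgetPex (P := [set B | is_min_monomial_gens J B]) set0 (ex_intro _ B HB)).
Qed.

End MonomialBasis.

(* Main.v *)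
Require Import Defs.
From HB Require Import structures.
From mathcomp Require Import all_boot all_order all_algebra.
From mathcomp Require Import boolp classical_sets functions cardinality.
From mathcomp Require Import mpoly zify.
Import GRing.Theory.
Local Open Scope ring_scope.
Local Open Scope classical_set_scope.

(** Membership in each ideal concerned is decided monomial by monomial. For the
    ideal generated by the [x_i^(l_i)] with [i != k], a monomial [x^c] lies in
    the [m]-th power exactly when one can split off [m] generators, that is,
    when [\sum_(i != k) floor (c_i / l_i)] is at least [m]
    ([ideal_pow_supported]). Hence [x^c] lies in [Gamma] exactly when the vector
    [b] of the [floor (c_i / l_i)] satisfies [\sum_(i != k) b_i >= m] for all
    [k] ([Gamma_supported]), and the minimal generators of [Gamma] are the
    [x^(l b)] with [b] minimal for this condition.

    What remains is combinatorics of vectors of natural numbers. The condition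
    says that [\sum_i b_i] is at least [m] plus the largest entry. If [b] is
    minimal and its largest entry [t] is at [u], lowering [b_u] must violate the
    constraint at some [k != u]; this forces both [\sum_i b_i = m + t] and
    [b_k = t] ([robust_ge_extremal]). Conversely, if [\sum_i b_i = m + t] and the
    maximum [t] is attained twice, then wherever [b] is lowered, one of the two
    maximal positions is different and its constraint, which was tight, fails
    ([extremal_minimal]).

    This works for all positive weights; [Gammabar] is the case of weights [1],
    and [Phi] matches the two resulting bases generator by generator. *)

(** * Vectors whose sum stays large when an entry is removed *)

Definition robust {n : nat} (m : nat) (b : 'I_n -> nat) : Prop :=
  forall k : 'I_n, (m <= \sum_(i < n | i != k) b i)%N.

Definition extremal {n : nat} (m t : nat) (b : 'I_n -> nat) : Prop :=
  [/\ (\sum_(i < n) b i = m + t)%N,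
      forall i : 'I_n, (b i <= t)%N
    & exists u v : 'I_n, [/\ (u < v)%N, b u = t & b v = t]].

Lemma sum_split {n : nat} (b : 'I_n -> nat) (k : 'I_n) :
  (\sum_(i < n) b i = b k + \sum_(i < n | i != k) b i)%N.
Proof. by rewrite (bigD1 k). Qed.

Lemma sum_split2 {n : nat} (b : 'I_n -> nat) {k j : 'I_n} : j != k ->
  (\sum_(i < n | i != k) b i =
     b j + \sum_(i < n | (i != k) && (i != j)) b i)%N.
Proof. by move=> jk; rewrite (bigD1 j). Qed.

Lemma extremal_robust {n m t : nat} {b : 'I_n -> nat} :
  extremal m t b -> robust m b.
Proof.
by case=> sb bt _ k; move: sb (bt k); rewrite (sum_split b k); lia.
Qed.

(** Where [b'] is smaller than [b], one of the two positions of the maximum of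
    [b] is elsewhere; removing it leaves exactly [m] from [b], hence less than
    [m] from [b']. *)
Lemma extremal_minimal {n m t : nat} {b b' : 'I_n -> nat} :
  extremal m t b -> robust m b' -> (forall i, b' i <= b i)%N -> b' =1 b.
Proof.
move=> [sb bt [u [v [uv bu bv]]]] rb' b'b j; apply/eqP.
rewrite eqn_leq b'b leqNgt /=; apply/negP => lt_j.
have [k kj bk] : exists2 k, j != k & b k = t.
  have [ju|] := eqVneq j u; last by exists u.
  by exists v => //; apply/eqP => jv; move: uv; rewrite -jv -ju ltnn.
have tight : (\sum_(i < n | i != k) b i = m)%N.
  by move: sb; rewrite (sum_split b k) bk; lia.
have := rb' k; rewrite -tight !(sum_split2 _ kj).
have : (\sum_(i < n | (i != k) && (i != j)) b' i <=
        \sum_(i < n | (i != k) && (i != j)) b i)%N by apply: leq_sum.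
lia.
Qed.

(** Keep lowering the largest entry while the vector stays robust. When this is
    no longer possible, the violated constraint and the one that still holds
    leave no choice but an extremal vector. *)
Lemma robust_ge_extremal {n m : nat} {b : 'I_n -> nat} :
  (0 < n)%N -> (0 < m)%N -> robust m b ->
  exists t b', [/\ (1 <= t <= m)%N, extremal m t b'
                 & forall i, (b' i <= b i)%N].
Proof.
move=> n_gt0 m_gt0; have [d] := ubnP (\sum_(i < n) b i)%N.
elim: d b => // d IH b sbd rb.
have [u _ umax] := @arg_maxnP _ (Ordinal n_gt0) xpredT b isT.
set t := b u in umax.
have su : (\sum_(i < n) b i = t + \sum_(i < n | i != u) b i)%N.
  exact: sum_split.
have t_gt0 : (0 < t)%N.
  rewrite lt0n; apply/eqP => t0; have := rb u; rewrite big1; first by lia.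
  by move=> i _; have := umax i isT; lia.
pose b1 i := if i == u then t.-1 else b i.
have b1u : b1 u = t.-1 by rewrite /b1 eqxx.
have b1D i : i != u -> b1 i = b i by rewrite /b1 => /negPf ->.
have sb1 : (\sum_(i < n | i != u) b1 i = \sum_(i < n | i != u) b i)%N.
  exact: eq_bigr.
have b1b i : (b1 i <= b i)%N.
  by have [->|/b1D ->//] := eqVneq i u; rewrite b1u leq_pred.
have [rb1|/existsNP[k /negP]] := pselect (robust m b1).
  have [|s [b' [sm eb' b'b1]]] := IH b1 _ rb1.
    suff : (\sum_(i < n) b1 i < \sum_(i < n) b i)%N by lia.
    by rewrite su (sum_split b1 u) b1u sb1; lia.
  by exists s, b'; split=> // i; exact: leq_trans (b'b1 i) (b1b i).
rewrite -ltnNge => sk.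
have uk : u != k.
  by apply/eqP => uk; have := rb u; move: sk; rewrite -uk sb1; lia.
(* The violated constraint at [k] and the valid one at [u] squeeze the sum. *)
have sbk : (\sum_(i < n | i != k) b i <= m)%N.
  have sb2 : (\sum_(i < n | (i != k) && (i != u)) b1 i =
              \sum_(i < n | (i != k) && (i != u)) b i)%N.
    by apply: eq_bigr => i /andP[_ /b1D].
  by move: sk; rewrite !(sum_split2 _ uk) b1u sb2 -/t; lia.
have sbk' : (\sum_(i < n) b i = b k + \sum_(i < n | i != k) b i)%N.
  exact: sum_split.
have ru := rb u; have bkt : (b k <= t)%N := umax k isT.
have bk : b k = t by lia.
have tk : (t <= \sum_(i < n | i != k) b i)%N.
  by rewrite (sum_split2 b uk) leq_addr.
exists t, b; split=> //; first by lia.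
split=> [|i|]; [by lia|exact: umax|].
have [uv|vu|/val_inj uv] := ltngtP u k; [by exists u, k|by exists k, u|].
by rewrite uv eqxx in uk.
Qed.

(** * Ideals determined by the supports of their elements *)

(** When [U] is closed upwards, this is the monomial ideal spanned by the
    monomials with exponent in [U]. *)
Definition supported (K : fieldType) (n : nat) (U : 'X_{1..n} -> Prop) :
    set {mpoly K[n]} :=
  [set p | forall c, c \in msupp p -> U c].

Arguments supported K {n} U _.

Lemma supportedX {K : fieldType} {n : nat} {U : 'X_{1..n} -> Prop} c :
  U c -> supported K U 'X_[c].
Proof. by move=> Uc a; rewrite msuppX inE => /eqP ->. Qed.

Lemma supported_ideal {K : fieldType} {n : nat} {U : 'X_{1..n} -> Prop} :
  (forall a c, U c -> U (a + c)%MM) -> is_ideal (supported K U).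
Proof.
move=> Uup; split=> [c|x y Ix Iy c|p q Iq c]; first by rewrite msupp0.
  by move/msuppD_le; rewrite mem_cat => /orP[/Ix|/Iy].
by move/msuppM_le/allpairsP => -[[c1 c2] /= [_ /Iq Uc ->]]; exact: Uup.
Qed.

Lemma supported_sub {K : fieldType} {n : nat} {U : 'X_{1..n} -> Prop}
    {I : set {mpoly K[n]}} :
  is_ideal I -> (forall c, U c -> I 'X_[c]) -> supported K U `<=` I.
Proof.
move=> [I0 ID IM] UI p Up; rewrite [p]mpolyE big_seq_cond.
apply: (big_ind I) => // c; rewrite andbT => /Up /UI Ic.
by rewrite -mul_mpolyC; exact: IM.
Qed.

(** * Powers of the ideals generated by powers of variables *)

Lemma ideal_pow0 {R : comNzRingType} (I : set R) x : ideal_pow I 0 x.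
Proof.
have [_ _ IM] := ideal_gen_ideal
  [set \prod_(j < 0) f j | f in [set f : 'I_0 -> R | forall j, I (f j)]].
rewrite -[x]mulr1; apply: IM; apply: sub_ideal_gen.
by exists (fun=> 0) => [[]//|]; rewrite big_ord0.
Qed.

Lemma ideal_powS {R : comNzRingType} {I : set R} {m x y} :
  I x -> ideal_pow I m y -> ideal_pow I m.+1 (x * y).
Proof.
move=> Ix; suff : ideal_pow I m `<=` [set y | ideal_pow I m.+1 (x * y)] by apply.
have [J0 JD JM] := ideal_gen_ideal
  [set \prod_(j < m.+1) f j | f in [set f : 'I_m.+1 -> R | forall j, I (f j)]].
apply: ideal_gen_min => [|_ [f If <-]] /=.
  split=> [|a b Ja Jb|a b Jb] /=; first by rewrite mulr0; exact: J0.
    by rewrite mulrDr; exact: JD.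
  by rewrite mulrCA; exact: JM.
apply: sub_ideal_gen; exists (fun j => oapp f x (unlift ord0 j)).
  by move=> j /=; case: (unlift ord0 j) => [i|] //=; exact: If.
rewrite big_ord_recl unlift_none /=; congr (_ * _).
by apply: eq_bigr => i _; rewrite liftK.
Qed.

Section PowersOfVariables.
Context (K : fieldType) (n : nat) (l : 'I_n -> nat).
Hypothesis l_gt0 : forall i, (0 < l i)%N.

Let varpow_ideal (k : 'I_n) : set {mpoly K[n]} :=
  ideal_gen [set 'X_i ^+ l i | i in [set i : 'I_n | i != k]].

(** The number of generators [x_i^(l_i)], [i != k], that can be split off the
    monomial [x^c], counted with multiplicity. *)
Let order (k : 'I_n) (c : 'X_{1..n}) : nat :=
  (\sum_(i < n | i != k) c i %/ l i)%N.

(** Only superadditive: the fractional parts lost by rounding down may add up to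
    a unit in the sum. *)
Let order_add k a c : (order k a + order k c <= order k (a + c)%MM)%N.
Proof.
rewrite /order -big_split /=; apply: leq_sum => i _.
by rewrite mnmDE divnD // leq_addr.
Qed.

Let order_varpow k i c : i != k ->
  order k (U_(i) *+ l i + c)%MM = (order k c).+1.
Proof.
move=> ik; rewrite /order (bigD1 i) //= [in RHS](bigD1 i) //= -addSn.
congr (_ + _)%N.
  by rewrite mnmDE mulmnE mnm1E eqxx mul1n divnDl ?dvdnn // divnn l_gt0.
apply: eq_bigr => j /andP[_ /negPf ji].
by rewrite mnmDE mulmnE mnm1E eq_sym ji mul0n.
Qed.

(** A monomial of order above [m] is a generator times a monomial of order one
    less, which gives the inclusion from right to left by induction on [m]. *)
Lemma ideal_pow_supported k m :
  ideal_pow (varpow_ideal k) m =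
    supported K (fun c => (m <= \sum_(i < n | i != k) c i %/ l i)%N).
Proof.
have F_ideal d : is_ideal (supported K (fun c => (d <= order k c)%N)).
  apply: supported_ideal => a c dc.
  by apply: leq_trans (order_add _ _ _); rewrite (leq_trans dc) ?leq_addl.
rewrite eqEsubset; split.
  apply: ideal_gen_min; first exact: F_ideal.
  have gen1 : varpow_ideal k `<=` supported K (fun c => (1 <= order k c)%N).
    apply: ideal_gen_min; first exact: F_ideal.
    move=> _ [i /= ik <-]; rewrite mpolyXn; apply: supportedX.
    by rewrite -[X in order k X]addm0 order_varpow.
  move=> _ [f If <-]; elim: m f If => [|m IH] f If; first by move=> c _.
  rewrite big_ord_recl => c /msuppM_le/allpairsP[[a b] /= [fa fb ->]].
  apply: leq_trans (order_add _ _ _); rewrite -add1n; apply: leq_add.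
    exact: gen1 (If ord0) _ fa.
  by apply: (IH (fun j => f (lift ord0 j))) fb => j; exact: If.
apply: supported_sub; first exact: ideal_gen_ideal.
elim: m => [|m IH] c mc; first exact: ideal_pow0.
have [i ik lc] : exists2 i : 'I_n, i != k & (l i <= c i)%N.
  apply: contrapT => none; move: mc; rewrite big1 // => i ik.
  by apply: divn_small; rewrite ltnNge; apply/negP => lc; apply: none; exists i.
have le_c : (U_(i) *+ l i <= c)%MM.
  apply/mnm_lepP => j; rewrite mulmnE mnm1E.
  by case: eqVneq => [<-|_]; rewrite ?mul1n ?mul0n.
have c_eq := submK le_c; rewrite addmC in c_eq.
rewrite -c_eq mpolyXD -mpolyXn; apply: ideal_powS.
  by apply: sub_ideal_gen; exists i.
have := mc; rewrite -/(order k c) -[in order k c]c_eq order_varpow //.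
exact: IH.
Qed.

(** * The minimal monomial generators of the intersection *)

Lemma Gamma_supported m :
  Gamma K m l = supported K (fun c => robust m (fun i => (c i %/ l i)%N)).
Proof.
rewrite /Gamma eqEsubset; split=> [p Gp c cp k|p Gp k _].
  by have := Gp k I; rewrite -/(varpow_ideal k) ideal_pow_supported; apply.
by rewrite -/(varpow_ideal k) ideal_pow_supported => c /Gp; apply.
Qed.

Let scale (b : 'I_n -> nat) : 'X_{1..n} := [multinom (l i * b i)%N | i < n].

Let scaleE b : \prod_(i < n) 'X_i ^+ (l i * b i) = 'X_[scale b] :> {mpoly K[n]}.
Proof. by rewrite mpolyXE_id; apply: eq_bigr => i _; rewrite mnmE. Qed.

Let scaleK b : (fun i => (scale b i %/ l i)%N) = b.
Proof. by apply: funext => i; rewrite mnmE mulKn. Qed.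

Definition extremal_gens (m : nat) : set {mpoly K[n]} :=
  \bigcup_(t in [set t : nat | (1 <= t <= m)%N])
    [set \prod_(i < n) 'X_i ^+ (l i * b i) | b in
      [set b : 'I_n -> nat | extremal m t b]].

(** Rounding exponents down to multiples of the weights reduces generation to
    [robust_ge_extremal], and irredundance to [extremal_minimal]. *)
Lemma extremal_gens_minimal {m} : (0 < n)%N -> (0 < m)%N ->
  is_min_monomial_gens (Gamma K m l) (extremal_gens m).
Proof.
move=> n_gt0 m_gt0.
have Bmon : extremal_gens m `<=` @monomials K n.
  by move=> _ [t _ [b _ <-]]; rewrite scaleE; exists (scale b).
have BG : extremal_gens m `<=` Gamma K m l.
  move=> _ [t _ [b eb <-]]; rewrite scaleE Gamma_supported; apply: supportedX.
  by rewrite scaleK; exact: extremal_robust eb.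
have G_ideal : is_ideal (Gamma K m l).
  rewrite Gamma_supported; apply: supported_ideal => a c rc k.
  by apply: leq_trans (order_add _ _ _); rewrite (leq_trans (rc k)) ?leq_addl.
split=> //.
  rewrite eqEsubset; split; last exact: ideal_gen_min.
  rewrite Gamma_supported; apply: supported_sub; first exact: ideal_gen_ideal.
  move=> c /(robust_ge_extremal n_gt0 m_gt0)[t [b [tm eb bc]]].
  apply: (@ideal_gen_dvd _ _ _ _ (scale b)).
    by apply: sub_ideal_gen; exists t => //; exists b => //; exact: scaleE.
  by apply/mnm_lepP => i; rewrite mnmE mulnC -leq_divRL.
move=> B' B'B GB'; rewrite eqEsubset; split=> // x Bx.
have := BG _ Bx; case: Bx => t _ [b eb <-]; rewrite scaleE GB'.
case/ideal_gen_monomialP => [y /B'B /Bmon //|c B'c cb].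
have rc : robust m (fun i => (c i %/ l i)%N).
  have : Gamma K m l 'X_[c] by apply: BG; exact: B'B.
  by rewrite Gamma_supported; apply; rewrite msuppX mem_head.
have cb_eq : (fun i => (c i %/ l i)%N) =1 b.
  apply: extremal_minimal eb rc _ => i; rewrite -[b in leqRHS]scaleK.
  by apply: leq_div2r; exact: mnm_lepP cb i.
suff -> : scale b = c by [].
apply/mnmP => i; apply/eqP; rewrite eqn_leq (mnm_lepP cb) andbT.
by rewrite mnmE -cb_eq mulnC leq_trunc_div.
Qed.

Lemma Gamma_basis {m} : (0 < n)%N -> (0 < m)%N ->
  monomial_basis (Gamma K m l) = extremal_gens m.
Proof.
move=> n_gt0 m_gt0; have minB := extremal_gens_minimal n_gt0 m_gt0.
have [Bmon GB _] := minB.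
apply: is_min_monomial_gens_unique (minB); apply: monomial_basisP.
by exists (extremal_gens m).
Qed.

End PowersOfVariables.

Arguments extremal_gens K {n} l m _.
Arguments extremal_gens_minimal K {n l} l_gt0 {m}.
Arguments Gamma_basis K {n l} l_gt0 {m}.

(** Holds by conversion, because a first power is the variable itself. *)
Lemma Gammabar_Gamma (K : fieldType) (n m : nat) :
  Gammabar K n m = Gamma K m (fun _ : 'I_n => 1%N).
Proof. by []. Qed.

Theorem lemma5p9 (K : fieldType) (n m : nat) (l : 'I_n -> nat)
    (Phi : {lrmorphism {mpoly K[n]} -> {mpoly K[n]}})
    (hK : infinite_set [set: K]) (hn : (2 <= n)%N) (hm : (1 <= m)%N)
    (hl : forall i, (0 < l i)%N)
    (hPhi : forall i : 'I_n, Phi 'X_i = 'X_i ^+ l i) :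
  [/\ weighted l (Gamma K m l),
      monomial_basis (Gamma K m l) = Phi @` monomial_basis (Gammabar K n m)
    & monomial_basis (Gamma K m l) =
      \bigcup_(t in [set t : nat | (1 <= t <= m)%N])
        [set \prod_(i < n) 'X_i ^+ (l i * b i) | b in
          [set b : 'I_n -> nat |
            [/\ (\sum_(i < n) b i = m + t)%N,
                forall i : 'I_n, (b i <= t)%N
              & exists u v : 'I_n, [/\ (u < v)%N, b u = t & b v = t]]]]].
Proof.
have n_gt0 : (0 < n)%N := ltnW hn.
rewrite /weighted Gammabar_Gamma !Gamma_basis //.
have PhiE b : Phi (\prod_(i < n) 'X_i ^+ (1 * b i)) =
    \prod_(i < n) 'X_i ^+ (l i * b i).
  rewrite rmorph_prod; apply: eq_bigr => i _.
  by rewrite rmorphXn /= hPhi mul1n exprM.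
split=> //.
  have [Bmon GB _] := extremal_gens_minimal K hl n_gt0 hm.
  split; first by exists (extremal_gens K l m).
  move=> _ [t _ [b _ <-]]; exists b => //.
  by apply: eq_bigr => i _; rewrite mulnC.
rewrite eqEsubset; split.
  move=> _ [t tm [b eb <-]]; rewrite -PhiE.
  by apply: imageP; exists t => //; exists b.
by move=> _ [_ [t tm [b eb <-]] <-]; rewrite PhiE; exists t => //; exists b.
Qed.
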